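(* The numeric functions $f:\mathbb{N}^p\to\mathbb{N}$ ($p\ge 0$) that are representable, via the Church numeral encoding, by closed safe lambda-terms of type $I\to\cdots\to I\to I$ ($p+1$ occurrences of $I$) are exactly the multivariate polynomials (with natural number coefficients).
   Context: Simple types are generated by $A ::= o \mid A \to A$ ($\to$ associates to the right); $(A_1,\ldots,A_n,B)$ abbreviates $A_1\to\cdots\to A_n\to B$. Orders: $\mathrm{ord}(o)=0$, $\mathrm{ord}(A\to B)=\max(\mathrm{ord}(A)+1,\mathrm{ord}(B))$. Terms are Church-style terms built from typed variables, without constants. The order of a term or variable is the order of its type. Safe lambda calculus. Judgements $\Gamma\vdash_{\sf s} M:A$ and $\Gamma\vdash_{\sf asa} M:A$ are defined by mutual induction. ''$c\le \mathrm{ord}\,\Gamma$'' means $c\le \mathrm{ord}(y)$ for every $y\in\Gamma$. (var) $x:A\vdash_{\sf s}x:A$. (wk) from $\Gamma\vdash_{\sf s}M:A$ infer $\Delta\vdash_{\sf s}M:A$ if $\Gamma\subset\Delta$. ($\delta$) from $\Gamma\vdash_{\sf s}M:A$ infer $\Gamma\vdash_{\sf asa}M:A$. (app$_{as}$) from $\Gamma\vdash_{\sf asa}M:A\to B$ and $\Gamma\vdash_{\sf s}N:A$ infer $\Gamma\vdash_{\sf asa}MN:B$. (app) from $\Gamma\vdash_{\sf asa}M:A\to B$ and $\Gamma\vdash_{\sf s}N:A$ infer $\Gamma\vdash_{\sf s}MN:B$, provided $\mathrm{ord}(B)\le\mathrm{ord}\,\Gamma$. (abs) from $\Gamma,x_1:A_1,\ldots,x_n:A_n\vdash_{\sf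 asa}M:B$ infer $\Gamma\vdash_{\sf s}\lambda x_1^{A_1}\ldots x_n^{A_n}.M:(A_1,\ldots,A_n,B)$, provided $\mathrm{ord}(A_1,\ldots,A_n,B)\le\mathrm{ord}\,\Gamma$. A term $M$ is safe if $\Gamma\vdash_{\sf s}M:T$ is derivable for some $\Gamma,T$. Church numerals: $I=((o,o),o,o)$ and $\overline{n}=\lambda s^{(o,o)}z^o.s^n z$ of type $I$ for $n\in\mathbb{N}$. A function $f:\mathbb{N}^p\to\mathbb{N}$ is represented by a term $F:(I,\ldots,I,I)$ ($p+1$ occurrences of $I$) if for all $m_1,\ldots,m_p\in\mathbb{N}$, $F\,\overline{m_1}\ldots\overline{m_p}=_\beta\overline{f(m_1,\ldots,m_p)}$. *)

(* Defs.v *)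
From mathcomp Require Import all_boot.
From Stdlib Require Import Relations.

Set Implicit Arguments.
Unset Strict Implicit.
Unset Printing Implicit Defensive.

Inductive ty : Type := O | Arr (A B : ty).

Fixpoint ord (A : ty) : nat :=
  if A is Arr A1 A2 then maxn (ord A1).+1 (ord A2) else 0.

(* (A_1, ..., A_n, B) *)
Definition arrs (As : seq ty) (B : ty) : ty := foldr Arr B As.

(* Church-style terms up to alpha-conversion, with de Bruijn indices. *)
Inductive term : Type :=
  | Var (i : nat)
  | App (M N : term)
  | Lam (A : ty) (M : term).

Definition lams (As : seq ty) (M : term) : term := foldr Lam M As.

Definition up_ren (r : nat -> nat) (i : nat) : nat :=
  if i is j.+1 then (r j).+1 else 0.

Fixpoint rename (r : nat -> nat) (M : term) : term :=
  match M with
  | Var i => Var (r i)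
  | App M1 M2 => App (rename r M1) (rename r M2)
  | Lam A M1 => Lam A (rename (up_ren r) M1)
  end.

Definition up (s : nat -> term) (i : nat) : term :=
  if i is j.+1 then rename succn (s j) else Var 0.

Fixpoint subst (s : nat -> term) (M : term) : term :=
  match M with
  | Var i => s i
  | App M1 M2 => App (subst s M1) (subst s M2)
  | Lam A M1 => Lam A (subst (up s) M1)
  end.

(* M[N/x], where x is the variable of index 0 *)
Definition subst0 (M N : term) : term :=
  subst (fun i => if i is j.+1 then Var j else N) M.

Inductive beta : term -> term -> Prop :=
  | beta_redex A M N : beta (App (Lam A M) N) (subst0 M N)
  | beta_appl M M' N : beta M M' -> beta (App M N) (App M' N)
  | beta_appr M N N' : beta N N' -> beta (App M N) (App M N')
  | beta_lam A M M' : beta M M' -> beta (Lam A M) (Lam A M').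

Definition beta_eq : term -> term -> Prop := clos_refl_sym_trans term beta.

(* A context is a finite set of typed variables, given as a finite partial map
   from indices to types: the variable of index i has type A when entry i is
   [Some A], and is not in the context when entry i is [None] or missing.  With
   total contexts, dropping an unused variable would renumber the term; here
   weakening is plain inclusion. *)
Definition ctx := seq (option ty).

Definition lookup (G : ctx) (i : nat) : option ty := nth None G i.

Definition ctx_sub (G D : ctx) : Prop :=
  forall i A, lookup G i = Some A -> lookup D i = Some A.

Definition ctx1 (i : nat) (A : ty) : ctx := ncons i None [:: Some A].

(* G, x_1 : A_1, ..., x_n : A_n; the last variable gets index 0. *)
Definition extend (G : ctx) (As : seq ty) : ctx := rev (map Some As) ++ G.

(* c <= ord G *)
Definition le_ord (c : nat) (G : ctx) : Prop :=
  forall i A, lookup G i = Some A -> c <= ord A.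

(* Plain simple typing; [has_type [::] M A] says that M is a closed term of
   type A. *)
Inductive has_type : ctx -> term -> ty -> Prop :=
  | ty_var G i A : lookup G i = Some A -> has_type G (Var i) A
  | ty_app G M N A B :
      has_type G M (Arr A B) -> has_type G N A -> has_type G (App M N) B
  | ty_lam G M A B :
      has_type (extend G [:: A]) M B -> has_type G (Lam A M) (Arr A B).

Inductive s_typing : ctx -> term -> ty -> Prop :=
  | s_var i A : s_typing (ctx1 i A) (Var i) A
  | s_wk G D M A : s_typing G M A -> ctx_sub G D -> s_typing D M A
  | s_app G M N A B :
      asa_typing G M (Arr A B) -> s_typing G N A -> le_ord (ord B) G ->
      s_typing G (App M N) B
  | s_abs G As M B :
      0 < size As ->
      asa_typing (extend G As) M B -> le_ord (ord (arrs As B)) G ->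
      s_typing G (lams As M) (arrs As B)
with asa_typing : ctx -> term -> ty -> Prop :=
  | asa_delta G M A : s_typing G M A -> asa_typing G M A
  | asa_app G M N A B :
      asa_typing G M (Arr A B) -> s_typing G N A -> asa_typing G (App M N) B.

Definition safe (M : term) : Prop := exists G A, s_typing G M A.

Definition church_ty : ty := arrs [:: Arr O O; O] O.

Definition church (n : nat) : term :=
  lams [:: Arr O O; O] (iter n (App (Var 1)) (Var 0)).

Definition apps (M : term) (Ns : seq term) : term := foldl App M Ns.

Definition represents (p : nat) (F : term) (f : p.-tuple nat -> nat) : Prop :=
  forall m : p.-tuple nat, beta_eq (apps F (map church m)) (church (f m)).

(* Polynomial functions over the semiring nat, as finite sums of monomials given
   by a coefficient and an exponent vector; {mpoly R[p]} needs a ring R. *)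
Definition is_polynomial (p : nat) (f : p.-tuple nat -> nat) : Prop :=
  exists P : seq (nat * p.-tuple nat), forall m : p.-tuple nat,
    f m = \sum_(c <- P) c.1 * \prod_(i < p) tnth m i ^ tnth c.2 i.

(* Main.v *)
(* From safe terms to polynomials: fix a variable [s] and call all other free variables
   ground atoms.  A logical predicate on families of terms indexed by the argument
   tuple [m] requires at type [O] that the family be convertible to [s^(q m) y] for one
   polynomial [q] and one ground atom [y], both independent of [m]; at an arrow type
   it requires good arguments to give good results, where arguments of positive
   order must moreover contain no ground atom.  Safe terms preserve the predicate,
   even when they are not normal, and Church numerals satisfy it: a good family of
   type [o -> o] without ground atoms is [y |-> s^(q m) y], and iterating it [m_i]
   times gives [y |-> s^(m_i * q m) y].  Applying a safe term of type
   [I -> ... -> I] to numerals, [s] and an atom therefore gives a polynomial number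
   of [s].

   Conversely a sum of monomials is [\xs s z. M_1 (M_2 ... (M_k z))], where
   [c * prod x_i^e_i] becomes [church c (x_1 (... (x_p s)))], each [x_i] repeated
   [e_i] times. *)

Require Import Defs.
From mathcomp Require Import all_boot.
From Stdlib Require Import Relations.

Set Implicit Arguments.
Unset Strict Implicit.
Unset Printing Implicit Defensive.

(** * Substitution *)

Fixpoint fv (i : nat) (M : term) : bool :=
  match M with
  | Var j => i == j
  | App M1 M2 => fv i M1 || fv i M2
  | Lam _ M1 => fv i.+1 M1
  end.

Definition scons (N : term) (s : nat -> term) (i : nat) : term :=
  if i is j.+1 then s j else N.

Lemma eq_rename r r' M : r =1 r' -> rename r M = rename r' M.
Proof.
elim: M r r' => [i|M IHM N IHN|A M IHM] r r' e /=; first by rewrite e.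
  by rewrite (IHM r r') // (IHN r r').
by congr Lam; apply: IHM => -[|i] //=; rewrite e.
Qed.

Lemma eq_in_subst s t M :
  (forall i, fv i M -> s i = t i) -> subst s M = subst t M.
Proof.
elim: M s t => [i|M IHM N IHN|A M IHM] s t e /=; first by apply: e => /=.
  by rewrite (IHM s t) 1?(IHN s t) // => i fi; apply: e; rewrite /= fi ?orbT.
by congr Lam; apply: IHM => -[|i] //= fi; rewrite e.
Qed.

Lemma eq_subst s t M : s =1 t -> subst s M = subst t M.
Proof. by move=> e; apply: eq_in_subst. Qed.

Lemma rename_comp r r' M : rename r (rename r' M) = rename (r \o r') M.
Proof.
elim: M r r' => [i|M IHM N IHN|A M IHM] r r' //=; first by rewrite IHM IHN.
by rewrite IHM; congr Lam; apply: eq_rename => -[].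
Qed.

Lemma subst_rename s r M : subst s (rename r M) = subst (s \o r) M.
Proof.
elim: M s r => [i|M IHM N IHN|A M IHM] s r //=; first by rewrite IHM IHN.
by rewrite IHM; congr Lam; apply: eq_subst => -[].
Qed.

Lemma rename_subst r s M : rename r (subst s M) = subst (rename r \o s) M.
Proof.
elim: M r s => [i|M IHM N IHN|A M IHM] r s //=; first by rewrite IHM IHN.
rewrite IHM; congr Lam; apply: eq_subst => -[|i] //=.
by rewrite !rename_comp.
Qed.

Lemma subst_comp t s M : subst t (subst s M) = subst (subst t \o s) M.
Proof.
elim: M t s => [i|M IHM N IHN|A M IHM] t s //=; first by rewrite IHM IHN.
rewrite IHM; congr Lam; apply: eq_subst => -[|i] //=.
by rewrite subst_rename rename_subst; apply: eq_subst.
Qed.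

Lemma subst_Var M : subst Var M = M.
Proof.
elim: M => [i|M IHM N IHN|A M IHM] //=; first by rewrite IHM IHN.
by rewrite -[in RHS]IHM; congr Lam; apply: eq_subst => -[].
Qed.

Lemma subst_closed s M : (forall i, ~~ fv i M) -> subst s M = M.
Proof.
move=> cM; rewrite -[RHS]subst_Var; apply: eq_in_subst => i.
by rewrite (negbTE (cM i)).
Qed.

Lemma rename_closed r M : (forall i, ~~ fv i M) -> rename r M = M.
Proof.
move=> cM; rewrite -[rename r M]subst_Var subst_rename; exact: subst_closed.
Qed.

Lemma subst0_up s M N : subst0 (subst (up s) M) N = subst (scons N s) M.
Proof.
rewrite /subst0 subst_comp; apply: eq_subst => -[|i] //=.
by rewrite subst_rename -[RHS]subst_Var; apply: eq_subst.
Qed.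

Lemma subst_subst0 s M N :
  subst s (subst0 M N) = subst0 (subst (up s) M) (subst s N).
Proof.
by rewrite subst0_up /subst0 subst_comp; apply: eq_subst => -[].
Qed.

(** * Beta-conversion *)

Lemma beta_eq_refl M : beta_eq M M. Proof. exact: rst_refl. Qed.
Lemma beta_eq_sym M N : beta_eq M N -> beta_eq N M. Proof. exact: rst_sym. Qed.
Lemma beta_eq_trans M N P : beta_eq M N -> beta_eq N P -> beta_eq M P.
Proof. exact: rst_trans. Qed.
#[local] Hint Resolve beta_eq_refl : core.

Lemma beta_eq_congr (c : term -> term) :
  (forall M N, beta M N -> beta (c M) (c N)) ->
  forall M N, beta_eq M N -> beta_eq (c M) (c N).
Proof.
move=> cb M N; elim=> [M1 N1 /cb|M1|M1 N1 _|M1 N1 P1 _ IH1 _].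
- exact: rst_step.
- exact: rst_refl.
- exact: rst_sym.
- exact: rst_trans IH1.
Qed.

Lemma beta_eq_app M M' N N' :
  beta_eq M M' -> beta_eq N N' -> beta_eq (App M N) (App M' N').
Proof.
move=> eM eN; apply: (@beta_eq_trans _ (App M' N)).
  by apply: (beta_eq_congr (c := App^~ N)) eM => *; exact: beta_appl.
by apply: (beta_eq_congr (c := App M')) eN => *; exact: beta_appr.
Qed.

Lemma beta_eq_lam A M M' : beta_eq M M' -> beta_eq (Lam A M) (Lam A M').
Proof. by apply: beta_eq_congr => *; exact: beta_lam. Qed.

Lemma beta_subst s M N : beta M N -> beta (subst s M) (subst s N).
Proof.
move=> b; elim: b s => /= [A M1 N1|M1 M2 N1 _ IH|M1 N1 N2 _ IH|A M1 M2 _ IH] s.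
- by rewrite subst_subst0; exact: beta_redex.
- exact: beta_appl.
- exact: beta_appr.
- exact: beta_lam.
Qed.

Lemma beta_eq_subst s M N : beta_eq M N -> beta_eq (subst s M) (subst s N).
Proof. by apply: beta_eq_congr => *; exact: beta_subst. Qed.

Lemma beta_eq_redex s A M N :
  beta_eq (App (subst s (Lam A M)) N) (subst (scons N s) M).
Proof. by rewrite -subst0_up; apply: rst_step; exact: beta_redex. Qed.

Lemma beta_eq_iter n M N P :
  beta_eq N P -> beta_eq (iter n (App M) N) (iter n (App M) P).
Proof. by move=> e; elim: n => //= n IH; exact: beta_eq_app. Qed.

Lemma beta_eq_apps M M' Ns : beta_eq M M' -> beta_eq (apps M Ns) (apps M' Ns).
Proof.
by elim: Ns M M' => //= N Ns IH M M' e; apply: IH; exact: beta_eq_app.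
Qed.

(** * Uniqueness of normal forms *)

(** Parallel reduction in the style of Tait and Martin-Löf. *)
Inductive par : term -> term -> Prop :=
  | par_var i : par (Var i) (Var i)
  | par_app M M' N N' : par M M' -> par N N' -> par (App M N) (App M' N')
  | par_lam A M M' : par M M' -> par (Lam A M) (Lam A M')
  | par_redex A M M' N N' :
      par M M' -> par N N' -> par (App (Lam A M) N) (subst0 M' N').

(** Takahashi's complete development, which contracts every redex visible in the term at once. *)
Fixpoint dev (M : term) : term :=
  match M with
  | Var i => Var i
  | App (Lam _ M1) N => subst0 (dev M1) (dev N)
  | App M1 N => App (dev M1) (dev N)
  | Lam A M1 => Lam A (dev M1)
  end.

Lemma par_refl M : par M M.
Proof. by elim: M => *; constructor. Qed.

Lemma beta_par M N : beta M N -> par M N.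
Proof. by elim=> *; constructor=> //; exact: par_refl. Qed.

Lemma par_rename r M N : par M N -> par (rename r M) (rename r N).
Proof.
move=> p; elim: p r => /= [i|M1 M2 N1 N2 _ IHM _ IHN|A M1 M2 _ IH
  |A M1 M2 N1 N2 _ IHM _ IHN] r; try by constructor.
rewrite (_ : rename r (subst0 M2 N2) =
             subst0 (rename (up_ren r) M2) (rename r N2)).
  exact: par_redex.
by rewrite /subst0 rename_subst subst_rename; apply: eq_subst => -[].
Qed.

Lemma par_subst s t M N :
  (forall i, par (s i) (t i)) -> par M N -> par (subst s M) (subst t N).
Proof.
move=> st p; elim: p s t st => /= [i|M1 M2 N1 N2 _ IHM _ IHN|A M1 M2 _ IH
  |A M1 M2 N1 N2 _ IHM _ IHN] s t st.
- exact: st.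
- by constructor; auto.
- constructor; apply: IH => -[|i] /=; [exact: par_var | exact: par_rename].
- rewrite subst_subst0; constructor; last exact: IHN.
  by apply: IHM => -[|i] /=; [exact: par_var | exact: par_rename].
Qed.

Lemma par_subst0 M M' N N' :
  par M M' -> par N N' -> par (subst0 M N) (subst0 M' N').
Proof.
move=> pM pN; apply: par_subst => // -[|i] //=; exact: par_var.
Qed.

(** The triangle property: whatever redexes a parallel step contracts, contracting the remaining
    ones leads to the complete development. *)
Lemma par_dev M N : par M N -> par N (dev M).
Proof.
elim=> [i|M1 M2 N1 N2 pM IHM _ IHN|A M1 M2 _ IH|A M1 M2 N1 N2 _ IHM _ IHN].
- exact: par_var.
- case: M1 pM IHM => [i|P Q|A P] pM IHM; try exact: par_app.
  inversion pM; subst; inversion IHM; subst.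
  exact: par_redex.
- exact: par_lam.
- exact: par_subst0.
Qed.

(** Two triangles per round: [N] steps to [dev M], hence [dev M] steps to [dev N]. *)
Lemma par_iter_dev n M N : par M N -> par (iter n dev M) (iter n dev N).
Proof. by move=> p; elim: n => //= n IH; apply: par_dev; exact: par_dev. Qed.

Definition normal (M : term) : Prop := forall N, par M N -> N = M.

(** This takes the place of confluence. Reaching [P] by repeated development is phrased as an
    equivalence, so symmetry and transitivity of conversion are immediate and only a single beta
    step needs an argument. *)
Lemma beta_eq_iter_dev M N P : normal P -> beta_eq M N ->
  (exists n, iter n dev M = P) <-> (exists n, iter n dev N = P).
Proof.
move=> nP; elim=> [M1 N1 /beta_par p|M1|M1 N1 _ IH|M1 N1 P1 _ IH1 _ IH2].
- split=> -[n e].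
    by exists n; apply: nP; rewrite -e; exact: par_iter_dev.
  (* One more round is needed because [N1] steps to [dev M1], not to [M1]. *)
  exists n.+1; apply: nP; rewrite -e iterSr.
  by apply: par_iter_dev; exact: par_dev.
- by [].
- exact: iff_sym.
- exact: iff_trans IH2.
Qed.

Lemma normal_beta_eq M N : normal M -> normal N -> beta_eq M N -> M = N.
Proof.
move=> nM nN e; have [_ [|n <-]] := beta_eq_iter_dev nN e; first by exists 0.
suff: iter n dev M = M by [].
elim: n => //= n ->; apply: nM; apply: par_dev; exact: par_refl.
Qed.

Lemma normal_iter n i j : normal (iter n (App (Var i)) (Var j)).
Proof.
elim: n => [|n IH] N /= p; inversion p; subst => //.
by rewrite (IH _ H3); inversion H1.
Qed.

Lemma beta_eq_iter_inj n n' i j j' :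
  beta_eq (iter n (App (Var i)) (Var j)) (iter n' (App (Var i)) (Var j')) ->
  n = n' /\ j = j'.
Proof.
move/(normal_beta_eq (@normal_iter _ _ _) (@normal_iter _ _ _)).
elim: n n' => [|n IH] [|n'] //=; first by case.
by case=> /IH[-> ->].
Qed.

(** * Typing *)

Scheme s_typing_min := Minimality for s_typing Sort Prop
  with asa_typing_min := Minimality for asa_typing Sort Prop.
Combined Scheme safe_ind from s_typing_min, asa_typing_min.

Lemma lookup_ctx1 i j A B : lookup (ctx1 i A) j = Some B -> j = i /\ B = A.
Proof.
rewrite /lookup /ctx1 nth_ncons; case: ltnP => // le_ij.
case e: (j - i) => [|k] /=; last by case: k {e}.
by case=> <-; split=> //; apply/eqP; rewrite eqn_leq le_ij -subn_eq0 e.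
Qed.

Lemma extend_cons G A As : extend G (A :: As) = extend (Some A :: G) As.
Proof. by rewrite /extend /= rev_cons cat_rcons. Qed.

Lemma ctx_sub_cons G D A : ctx_sub G D -> ctx_sub (A :: G) (A :: D).
Proof. by move=> GD [|i] //= B; exact: GD. Qed.

Lemma has_type_wk G D M A : has_type G M A -> ctx_sub G D -> has_type D M A.
Proof.
move=> t; elim: t D => [{}G i B l|{}G M1 N B C _ IHM _ IHN|{}G M1 B C _ IH] D GD.
- by apply: ty_var; exact: GD.
- by apply: ty_app (IHM _ GD) (IHN _ GD).
- by apply: ty_lam; apply: IH; exact: ctx_sub_cons.
Qed.

Lemma has_type_uniq G M A B : has_type G M A -> has_type G M B -> A = B.
Proof.
move=> t; elim: t B => [{}G i C l|{}G M1 N C D _ IHM _ _|{}G M1 C D _ IH] B t.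
- by inversion t; subst; move: H1; rewrite l => -[].
- by inversion t; subst; case: (IHM _ H2).
- by inversion t; subst; congr Arr; exact: IH.
Qed.

Lemma has_type_lams G As M B :
  has_type (extend G As) M B -> has_type G (lams As M) (arrs As B).
Proof.
elim: As G => [//|A As IH] G; rewrite extend_cons => /IH t; exact: ty_lam.
Qed.

Lemma safe_has_type :
  (forall G M A, s_typing G M A -> has_type G M A) /\
  (forall G M A, asa_typing G M A -> has_type G M A).
Proof.
apply: safe_ind => //.
- by move=> i A; apply: ty_var; rewrite /lookup /ctx1 nth_ncons ltnn subnn.
- by move=> G D M A _ t GD; exact: has_type_wk GD.
- by move=> G M N A B _ tM _ tN _; exact: ty_app tN.
- by move=> G As M B _ _ t _; exact: has_type_lams.
- by move=> G M N A B _ tM _ tN; exact: ty_app tN.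
Qed.

Lemma fv_lookup G M A i : has_type G M A -> fv i M -> exists B, lookup G i = Some B.
Proof.
move=> t; elim: t i => [{}G i B l|{}G M1 N B C _ IHM _ IHN|{}G M1 B C _ IH] j /=.
- by move/eqP->; exists B.
- by case/orP; [exact: IHM | exact: IHN].
- by move/IH.
Qed.

Lemma has_type_closed M A : has_type [::] M A -> forall i, ~~ fv i M.
Proof.
by move=> t i; apply/negP => /(fv_lookup t)[B]; rewrite /lookup nth_nil.
Qed.

(** The side conditions of application and abstraction bound the whole context. Weakening may add
    variables of lower order, but these do not occur in the term, so the bound survives for free
    variables. *)
Lemma safe_fv_ord G M A i : s_typing G M A -> fv i M ->
  exists2 B, lookup G i = Some B & ord A <= ord B.
Proof.
have le G0 M0 A0 : has_type G0 M0 A0 -> le_ord (ord A0) G0 -> fv i M0 ->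
    exists2 B, lookup G0 i = Some B & ord A0 <= ord B.
  by move=> t o /(fv_lookup t)[B l]; exists B => //; exact: o l.
elim=> {G M A} [j A|G D M A _ IH GD|G M N A B tM tN _|G As M B s tM].
- move=> /eqP->; exists A => //.
  by rewrite /lookup /ctx1 nth_ncons ltnn subnn.
- by move/IH=> [B /GD l o]; exists B.
- by move=> o; apply: le => //; exact: (proj1 safe_has_type _ _ _ (s_app tM tN o)).
- by move=> o; apply: le => //; exact: (proj1 safe_has_type _ _ _ (s_abs s tM o)).
Qed.

Lemma church_s_typing n : s_typing [::] (church n) church_ty.
Proof.
have v G i A : lookup G i = Some A -> s_typing G (Var i) A.
  by move=> l; apply: s_wk (s_var i A) _ => j B /lookup_ctx1[-> ->].
apply: s_abs => //; last by move=> i A; rewrite /lookup nth_nil.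
apply: asa_delta; elim: n => [|n IH] /=; first exact: v.
by apply: s_app (asa_delta (v _ 1 (Arr O O) _)) IH _.
Qed.

Lemma church_closed n i : ~~ fv i (church n).
Proof. exact: has_type_closed (proj1 safe_has_type _ _ _ (church_s_typing n)) i. Qed.

Lemma subst_iter s n M N :
  subst s (iter n (App M) N) = iter n (App (subst s M)) (subst s N).
Proof. by elim: n => //= n ->. Qed.

Lemma church_app n M N :
  beta_eq (App (App (church n) M) N) (iter n (App M) N).
Proof.
apply: (@beta_eq_trans _ (App (subst (scons M Var)
    (Lam O (iter n (App (Var 1)) (Var 0)))) N)).
  by apply: beta_eq_app => //; rewrite -{1}[church n]subst_Var; exact: beta_eq_redex.
by apply: beta_eq_trans (beta_eq_redex _ _ _ _) _; rewrite subst_iter.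
Qed.

(** * Polynomials *)

Section Polynomials.
Variable p : nat.
Implicit Types f g : p.-tuple nat -> nat.

Lemma is_polynomial_ext f g : f =1 g -> is_polynomial f -> is_polynomial g.
Proof. by move=> fg [P e]; exists P => m; rewrite -fg. Qed.

Lemma is_polynomial_const c : is_polynomial (fun _ : p.-tuple nat => c).
Proof.
exists [:: (c, [tuple 0 | j < p])] => m; rewrite big_seq1 /= big1 ?muln1 // => i _.
by rewrite tnth_mktuple.
Qed.

Lemma is_polynomial_add f g :
  is_polynomial f -> is_polynomial g -> is_polynomial (fun m => f m + g m).
Proof.
by move=> [P eP] [Q eQ]; exists (P ++ Q) => m; rewrite big_cat /= eP eQ.
Qed.

Lemma is_polynomial_mulX i f :
  is_polynomial f -> is_polynomial (fun m => tnth m i * f m).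
Proof.
move=> [P eP].
exists [seq (c.1, [tuple tnth c.2 j + (j == i) | j < p]) | c : nat * p.-tuple nat <- P] => m.
rewrite big_map eP big_distrr /=; apply: eq_bigr => c _.
rewrite mulnCA; congr (_ * _).
rewrite [in LHS](bigD1 i) //= [in RHS](bigD1 i) //= mulnA.
rewrite tnth_mktuple eqxx addn1 expnS; congr (_ * _).
by apply: eq_bigr => j /negbTE ne; rewrite tnth_mktuple ne addn0.
Qed.

End Polynomials.

(** * The logical predicate *)

Section Good.
Variable p : nat.
Implicit Types v u : p.-tuple nat -> term.

(* The fixed variable [s] is [Var 0]; every [Var i.+1] is a ground atom. *)
Definition rigid (M : term) : Prop :=
  forall s, s 0 = Var 0 -> subst s M = M.

Fixpoint good (A : ty) (v : p.-tuple nat -> term) : Prop :=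
  match A with
  | O => exists i q, is_polynomial q /\
      forall m, beta_eq (v m) (iter (q m) (App (Var 0)) (Var i.+1))
  | Arr A B => forall u, good A u -> (0 < ord A -> forall m, rigid (u m)) ->
      good B (fun m => App (v m) (u m))
  end.

Lemma good_beta_eq A v v' :
  (forall m, beta_eq (v m) (v' m)) -> good A v -> good A v'.
Proof.
elim: A v v' => [|A _ B IH] v v' e /=.
  move=> [i [q [pq vq]]]; exists i, q; split=> // m.
  exact: beta_eq_trans (beta_eq_sym (e m)) (vq m).
move=> gv u gu ru; apply: (IH _ _ _ (gv u gu ru)) => m; exact: beta_eq_app.
Qed.

(** Only variables occurring in [M] are constrained, so weakening is harmless and every substitution
    qualifies for a closed term. *)
Definition good_env (G : ctx) (M : term) (s : p.-tuple nat -> nat -> term) : Prop :=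
  forall i A, fv i M -> lookup G i = Some A ->
    good A (s^~ i) /\ (0 < ord A -> forall m, rigid (s m i)).

Lemma good_lams G As M B :
  (forall s, good_env (extend G As) M s -> good B (fun m => subst (s m) M)) ->
  forall s, good_env G (lams As M) s ->
    good (arrs As B) (fun m => subst (s m) (lams As M)).
Proof.
elim: As G => [//|A As IH] G; rewrite extend_cons => gM s gs u gu ru.
apply: (@good_beta_eq _ (fun m => subst (scons (u m) (s m)) (lams As M))).
  by move=> m; apply: beta_eq_sym; exact: beta_eq_redex.
by apply: (IH _ gM) => -[|i] C fi /= l; [case: l => <- | exact: gs].
Qed.

(** By [safe_fv_ord] every free variable of [M] has positive order too, so its image is rigid. *)
Lemma rigid_subst G M A s : s_typing G M A -> 0 < ord A -> good_env G M s ->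
  forall m, rigid (subst (s m) M).
Proof.
move=> tM oA gs m t t0; rewrite subst_comp; apply: eq_in_subst => i fi.
have [B l o] := safe_fv_ord tM fi.
by have [_] := gs i B fi l; apply=> //; exact: leq_trans o.
Qed.

(* Safety enters only here, through [rigid_subst]: an argument of positive order
   contains no ground atom. *)
Lemma good_safe :
  (forall G M A, s_typing G M A ->
     forall s, good_env G M s -> good A (fun m => subst (s m) M)) /\
  (forall G M A, asa_typing G M A ->
     forall s, good_env G M s -> good A (fun m => subst (s m) M)).
Proof.
have app G M N A B : s_typing G N A ->
    (forall s, good_env G M s -> good (Arr A B) (fun m => subst (s m) M)) ->
    (forall s, good_env G N s -> good A (fun m => subst (s m) N)) ->
    forall s, good_env G (App M N) s -> good B (fun m => subst (s m) (App M N)).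
  move=> tN gM gN s gs.
  have gsN : good_env G N s by move=> i C fi; apply: gs; rewrite /= fi orbT.
  apply: gM; first by move=> i C fi; apply: gs; rewrite /= fi.
    exact: gN.
  by move=> oA; exact: rigid_subst tN oA gsN.
apply: safe_ind => //.
- move=> i A s gs; have [||//] := gs i A.
  + by rewrite /= eqxx.
  + by rewrite /lookup /ctx1 nth_ncons ltnn subnn.
- by move=> G D M A _ IH GD s gs; apply: IH => i B fi /GD; exact: gs.
- by move=> G M N A B _ gM tN gN _; exact: app gM gN.
- by move=> G As M B _ _ gM _; exact: good_lams.
- by move=> G M N A B _ gM tN gN; exact: app gM gN.
Qed.

(* Invariance of [f m] under substitution of the ground atoms forces
   [App (f m) (Var 1)] to be convertible to an expression in the atom [Var 1]
   itself, which can then be replaced by any [N]. *)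
Lemma good_unary f : good (Arr O O) f -> (forall m, rigid (f m)) ->
  exists q, is_polynomial q /\
    forall m N, beta_eq (App (f m) N) (iter (q m) (App (Var 0)) N).
Proof.
move=> gf rf.
have [] := gf (fun=> Var 1) => [|//|j [q [pq e]]].
  exists 0, (fun=> 0); split; [exact: is_polynomial_const | by move=> m].
exists q; split=> // m N.
have j0 : j = 0.
  apply/eqP/negPn/negP => j_neq0.
  (* For [j] nonzero, [t] fixes [App (f m) (Var 1)] but turns the atom of its value into [Var 1],
     against uniqueness of normal forms. *)
  pose t i := if i == j.+1 then Var 1 else Var i.
  have := beta_eq_subst t (e m).
  rewrite /= rf // subst_iter /= {3}/t eqxx {1}/t eqSS eq_sym (negbTE j_neq0).
  move=> /beta_eq_sym/beta_eq_trans/(_ (e m)) /beta_eq_iter_inj[_ [j0]].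
  by rewrite -j0 in j_neq0.
pose t i := if i == 1 then N else Var i.
by have := beta_eq_subst t (e m); rewrite /= rf // subst_iter j0.
Qed.

Lemma good_church (i : 'I_p) : good church_ty (fun m => church (tnth m i)).
Proof.
move=> f gf /(_ isT) rf u [j [r [pr er]]] _.
have [q [pq eq]] := good_unary gf rf.
(* The start [u m] contributes [r m] copies of [s] and the atom [j]; each of the [tnth m i] passes
   through [f] adds [q m] copies. *)
exists j, (fun m => tnth m i * q m + r m); split.
  by apply: is_polynomial_add => //; exact: is_polynomial_mulX.
move=> m; apply: beta_eq_trans (church_app _ _ _) _.
apply: beta_eq_trans (beta_eq_iter _ _ (er m)) _.
rewrite iterD; elim: (tnth m i) => //= n IH; rewrite mulSn iterD.
apply: beta_eq_trans (eq _ _) _; exact: beta_eq_iter.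
Qed.

Lemma good_apps n B v (t : seq 'I_p) :
  size t = n -> good (arrs (nseq n church_ty) B) v ->
  good B (fun m => apps (v m) [seq church (tnth m i) | i <- t]).
Proof.
move=> <-; elim: t v => [//|i t IH] v /= gv; apply: IH; apply: gv.
  exact: good_church.
by move=> _ m s _; apply: subst_closed; exact: church_closed.
Qed.

End Good.

Lemma representable_is_polynomial p (f : p.-tuple nat -> nat) F :
  has_type [::] F (arrs (nseq p church_ty) church_ty) -> safe F ->
  represents F f -> is_polynomial f.
Proof.
move=> tF [G [A sF]] rF.
have cF := has_type_closed tF.
(* Safety comes with its own context and type; uniqueness of types identifies the latter with the
   given one. *)
have eA : arrs (nseq p church_ty) church_ty = A.
  apply: has_type_uniq (proj1 safe_has_type _ _ _ sF).
  by apply: has_type_wk tF _ => i B; rewrite /lookup nth_nil.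
have gF : good A (fun _ : p.-tuple nat => F).
  apply: (@good_beta_eq _ _ (fun=> subst Var F)); first by move=> m; rewrite subst_Var.
  by apply: (proj1 (good_safe p) _ _ _ sF (fun=> Var)) => i B; rewrite (negbTE (cF i)).
move: gF; rewrite -eA => /(good_apps (size_enum_ord p)) gF.
(* After the numerals, the arguments are [s], which is good since it adds one copy of itself, and
   the atom [Var 1]. *)
have [] := gF (fun=> Var 0) _ _ (fun=> Var 1).
- move=> u [i [q [pq e]]] _; exists i, (fun m => q m + 1); split.
    by apply: is_polynomial_add => //; exact: is_polynomial_const.
  by move=> m; rewrite addn1; exact: beta_eq_app.
- by move=> _ m s.
- by exists 0, (fun=> 0); split=> //; exact: is_polynomial_const.
- by [].
move=> i [q [pq e]]; apply: is_polynomial_ext pq => m.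
have := e m; rewrite -/(map _ _) (map_comp church (tnth m)) map_tnth_enum.
move=> em.
(* Since [F] represents [f], the same application also yields [f m] copies of [s] over [Var 1]. *)
suff /beta_eq_iter_inj[] : beta_eq (iter (q m) (App (Var 0)) (Var i.+1))
   (iter (f m) (App (Var 0)) (Var 1)) by [].
apply: beta_eq_trans (beta_eq_sym em) _.
apply: beta_eq_trans (church_app _ _ _).
by do 2!apply: beta_eq_app => //.
Qed.

(** * Representing polynomials *)

Lemma apps_lams s As M Ns : size As = size Ns ->
  beta_eq (apps (subst s (lams As M)) Ns)
          (subst (foldl (fun s N => scons N s) s Ns) M).
Proof.
elim: As Ns s => [|A As IH] [|N Ns] //= s [eAN].
apply: beta_eq_trans (IH _ _ eAN); apply: beta_eq_apps; exact: beta_eq_redex.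
Qed.

(** The last argument is pushed last and so gets index 0, hence the reversal. *)
Lemma foldl_scons s Ns i N0 : i < size Ns ->
  foldl (fun s N => scons N s) s Ns i = nth N0 (rev Ns) i.
Proof.
elim/last_ind: Ns s i => [//|Ns N IH] s i.
rewrite foldl_rcons rev_rcons size_rcons; case: i => //= i; exact: IH.
Qed.

Section PolynomialTerm.
Variable p : nat.

(* Under the binders [x_1 ... x_p s z], the index of [x_(i+1)] is
   [(p - i.+1).+2], [s] is [Var 1] and [z] is [Var 0]. *)
Definition monomial_fun (e : p.-tuple nat) : term :=
  foldr (fun i : 'I_p => iter (tnth e i) (App (Var (p - i.+1).+2)))
    (Var 1) (index_enum 'I_p).

Definition polynomial_body (P : seq (nat * p.-tuple nat)) : term :=
  foldr (fun c => App (App (church c.1) (monomial_fun c.2))) (Var 0) P.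

Definition polynomial_term P : term :=
  lams (nseq p church_ty ++ [:: Arr O O; O]) (polynomial_body P).

Lemma s_typing_Var G i A : lookup G i = Some A -> s_typing G (Var i) A.
Proof. by move=> l; apply: s_wk (s_var i A) _ => j B /lookup_ctx1[-> ->]. Qed.

Lemma polynomial_term_s_typing P :
  s_typing [::] (polynomial_term P) (arrs (nseq p church_ty) church_ty).
Proof.
rewrite (_ : arrs _ _ = arrs (nseq p church_ty ++ [:: Arr O O; O]) O);
  last by rewrite /arrs foldr_cat.
apply: s_abs; rewrite ?size_cat ?addn2 //; last first.
  by move=> i A; rewrite /lookup nth_nil.
have -> : extend [::] (nseq p church_ty ++ [:: Arr O O; O]) =
    [:: Some O, Some (Arr O O) & nseq p (Some church_ty)].
  by rewrite /extend cats0 map_cat map_nseq rev_cat /= rev_nseq.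
set D := nseq p _.
(* The factors applied in the sum have order 1, so they can be typed safely only without the order-0
   variable [z]. The entry [None] removes [z] without shifting the other indices. *)
pose G := [:: None, Some (Arr O O) & D].
have oG : le_ord 1 G.
  by move=> [|[|i]] //= A; rewrite /lookup /= ?nth_nseq; [case=> <-|case: ifP => // _ [<-]].
apply: asa_delta; elim: P => [|[c e] P IH] /=; first exact: s_typing_Var.
apply: s_app (asa_delta _) IH _ => //.
apply: (@s_wk G); last by case.
apply: s_app (asa_delta _) _ _; last exact: oG.
  by apply: s_wk (church_s_typing c) _ => i A; rewrite /lookup nth_nil.
rewrite /monomial_fun; elim: (index_enum _) => [|i s IHs] /=.
  exact: s_typing_Var.
elim: (tnth e i) => //= k IHk.
apply: s_app; [apply: asa_delta; apply: s_typing_Var | exact: IHk | exact: oG].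
by rewrite /lookup [nth _ _ _]nth_nseq (ltn_ord (rev_ord i)).
Qed.

(** Stated on applied terms because there is no eta: [s] alone is not beta-convertible to
    [\z. s z]. *)
Definition acts (W : term) (k : nat) : Prop :=
  forall N, beta_eq (App W N) (iter k (App (Var 1)) N).

Lemma acts_church n W k : acts W k -> acts (App (church n) W) (n * k).
Proof.
move=> aW N; apply: beta_eq_trans (church_app _ _ _) _.
elim: n => //= n IH; rewrite mulSn iterD.
apply: beta_eq_trans (aW _) _; exact: beta_eq_iter.
Qed.

Lemma polynomial_term_represents P :
  represents (polynomial_term P) (fun m : p.-tuple nat =>
    \sum_(c <- P) c.1 * \prod_(i < p) tnth m i ^ tnth c.2 i).
Proof.
move=> m; rewrite /polynomial_term /lams foldr_cat -[foldr _ _ _]subst_Var.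
apply: beta_eq_trans (apps_lams _ _ _) _.
  by rewrite size_nseq size_map size_tuple.
set s := foldl _ _ _.
do 2!apply: beta_eq_lam; set t := up (up s).
have tx (i : 'I_p) : t (p - i.+1).+2 = church (tnth m i).
  rewrite /t [LHS]/= /s (@foldl_scons _ _ _ (Var 0)); last first.
    by rewrite size_map size_tuple; exact: (ltn_ord (rev_ord i)).
  rewrite -map_rev (nth_map 0); last first.
    by rewrite size_rev size_tuple; exact: (ltn_ord (rev_ord i)).
  rewrite nth_rev ?size_tuple; last exact: (ltn_ord (rev_ord i)).
  (* The index [p - i.+1] is the value of [rev_ord i]; reading the reversed list there reverses a
     second time and gives back position [i]. *)
  rewrite -[p - _]/(nat_of_ord (rev_ord (rev_ord i))) rev_ordK -tnth_nth.
  by rewrite !(rename_closed _ (@church_closed _)).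
have acts_monomial e :
    acts (subst t (monomial_fun e)) (\prod_(i < p) tnth m i ^ tnth e i).
  (* Unlocking shows the product as a fold over the same [index_enum] as the monomial, so one
     induction treats both. *)
  rewrite unlock /monomial_fun; elim: (index_enum _) => [|i r IH] //=.
  rewrite subst_iter [subst t (Var _)]tx; elim: (tnth e i) => [|k IHk] /=.
    by rewrite expn0 mul1n.
  by rewrite expnS -mulnA; exact: acts_church.
rewrite -/(subst t (polynomial_body P)).
elim: P => [|c P IH]; first by rewrite big_nil.
rewrite big_cons iterD.
have -> : subst t (polynomial_body (c :: P)) =
    App (App (church c.1) (subst t (monomial_fun c.2)))
      (subst t (polynomial_body P)).
  by rewrite -(subst_closed t (@church_closed c.1)).
apply: beta_eq_trans (acts_church _ (acts_monomial _) _) _.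
exact: beta_eq_iter.
Qed.

End PolynomialTerm.

Theorem theorem2p2 (p : nat) (f : p.-tuple nat -> nat) :
  (exists F : term,
     [/\ has_type [::] F (arrs (nseq p church_ty) church_ty),
         safe F
       & represents F f])
  <-> is_polynomial f.
Proof.
split=> [[F [tF sF rF]]|[P fP]]; first exact: representable_is_polynomial rF.
have sF := polynomial_term_s_typing P.
exists (polynomial_term P); split.
- exact: (proj1 safe_has_type).
- by exists [::], (arrs (nseq p church_ty) church_ty).
- by move=> m; rewrite fP; exact: polynomial_term_represents.
Qed.
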